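(* Assume: (h) $\mathsf A$ is an infinite compact subset of $\mathbb R^d$ for some $d\ge1$; (j) $c$ is bounded and there is $K_1\ge0$ with $|c(x,\tilde a)-c(x,a)|\le K_1 d_{\mathsf A}(\tilde a,a)$ for all $x\in\mathsf X$ and $a,\tilde a\in\mathsf A$; (k) there is $K_2\ge0$ with $\|p(\,\cdot\,|x,\tilde a)-p(\,\cdot\,|x,a)\|_{TV}\le K_2 d_{\mathsf A}(\tilde a,a)$ for all $x\in\mathsf X$ and $a,\tilde a\in\mathsf A$. Let $\beta\in(0,1)$, let $\pi\in S$ and let $\{\pi^k\}_{k\ge1}$ be the quantized approximations of $\pi$. Then for any initial distribution $\mu$ and all $k\ge1$, $$|w_\beta(\pi,\mu)-w_\beta(\pi^k,\mu)|\le K(1/k)^{1/d},$$ where $$K=\frac{\alpha}{1-\beta}\Big(K_1-\beta K_2M+\frac{2\beta MK_2}{1-\beta}\Big),\qquad M:=\sup_{(x,a)\in\mathsf X\times\mathsf A}|c(x,a)|.$$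
   Context: Markov decision process: the state space $\mathsf X$ is a Polish space with its Borel $\sigma$-algebra, the action space $\mathsf A$ is as in (h); every action is admissible in every state; $p(\,\cdot\,|x,a)$ is a stochastic kernel on $\mathsf X$ given $\mathsf X\times\mathsf A$ (transition probability); the one-stage cost $c:\mathsf X\times\mathsf A\to[0,\infty)$ is measurable. ''Measurable'' means Borel measurable. $d_{\mathsf A}$ is the Euclidean distance on $\mathsf A$ inherited from $\mathbb R^d$. $\|\cdot\|_{TV}$ is the total variation norm; for probability measures, $\|\nu-\eta\|_{TV}=2\sup_{B}|\nu(B)-\eta(B)|$. A deterministic stationary policy $\pi$ is given (induced) by a measurable function $f:\mathsf X\to\mathsf A$: at each time $n$ the action is $a_n=f(x_n)$. $S$ denotes the set of all deterministic stationary policies. $E^\pi_\mu$ is expectation for the process $(x_0,a_0,x_1,a_1,\dots)$ with $x_0\sim\mu$, actions chosen by $\pi$, and $x_{n+1}\sim p(\,\cdot\,|x_n,a_n)$ given the past. Discounted cost: $w_\beta(\pi,\mu)=E^\pi_\mu\big[\sum_{n=0}^\infty\beta^nc(x_n,a_n)\big]$. Quantized approximations and the constant $\alpha$: since $\mathsf A$ is an infinite compact subset of $\mathbb R^d$, there are a constant $\alpha>0$ and finite sets $\Lambda_k\subset\mathsf A$ with $|\Lambda_k|=k$ such that $\max_{x\in\mathsf A}\min_{y\in\Lambda_k}d_{\mathsf A}(x,y)\le\alpha(1/k)^{1/d}$ for all $k\ge1$; fix such $\alpha$ and $\Lambda_k$. If $\pi\in S$ is induced by $f$, let $q_k:\mathsf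 X\to\Lambda_k$, $q_k(x)=\arg\min_{a\in\Lambda_k}d_{\mathsf A}(f(x),a)$, with ties broken so that $q_k$ is measurable; hence $\sup_{x\in\mathsf X}d_{\mathsf A}(q_k(x),f(x))\le\alpha(1/k)^{1/d}$. The policy $\pi^k\in S$ induced by $q_k$ is the ($k$-th) quantized approximation of $\pi$. *)

(* Defs.v *)
(* MathComp-Analysis *)
From HB Require Import structures.
From mathcomp Require Import all_boot all_order all_algebra.
From mathcomp Require Import all_classical all_reals all_analysis.

Set Implicit Arguments.
Unset Strict Implicit.
Unset Printing Implicit Defensive.
Import Order.TTheory GRing.Theory Num.Theory numFieldNormedType.Exports.
Local Open Scope classical_set_scope.
Local Open Scope ring_scope.

Notation borel T := (g_sigma_algebraType (@open T)).

Definition is_metric (R : realType) (T : Type) (dist : T -> T -> R) : Prop :=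
  [/\ forall x y, 0 <= dist x y,
      forall x y, dist x y = 0 <-> x = y,
      forall x y, dist x y = dist y x &
      forall x y z, dist x z <= dist x y + dist y z].

Definition polish_space (R : realType) (T : topologicalType) : Prop :=
  (exists2 D : set T, countable D & dense D) /\
  exists dist : T -> T -> R,
    [/\ is_metric dist,
        forall (x : T) (U : set T), nbhs x U <->
          (exists2 e : R, 0 < e & [set y | dist x y < e] `<=` U) &
        forall u : nat -> T,
          (forall e : R, 0 < e ->
             exists N, forall m n, (N <= m)%N -> (N <= n)%N ->
               dist (u m) (u n) < e) ->
          exists l : T, u n @[n --> \oo] --> l].

(* The norm of the library on ['rV[R]_d] is the sup norm, hence this
   definition; both distances induce the same topology. *)
Definition euclidean_dist (R : realType) (d : nat) (u v : 'rV[R]_d) : R :=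
  Num.sqrt (\sum_(i < d) (u ord0 i - v ord0 i) ^+ 2).

(* A set [A], seen as a type carrying the subspace topology. Measurable types
   of the library are pointed, and [Ainf] provides the required point. *)
Section action_space.
Context (R : realType) (d : nat) (A : set 'rV[R]_d).

Definition action_space (Ainf : infinite_set A) : Type := set_type A.

Lemma action_space_inhabited : infinite_set A -> exists a : set_type A, True.
Proof.
move=> Ainf; have [a Aa] := infinite_setN0 Ainf.
by exists (exist _ a (mem_set Aa)).
Qed.

Context (Ainf : infinite_set A).

HB.instance Definition _ := Topological.copy (action_space Ainf) (set_type A).
HB.instance Definition _ := isPointed.Build (action_space Ainf)
  (projT1 (cid (action_space_inhabited Ainf))).

Definition dA (a b : action_space Ainf) : R :=
  euclidean_dist (set_val a) (set_val b).

(* [max_x min_(y in L) dA x y]; for finite nonempty [L] and compact [A] both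
   extrema are attained. *)
Definition covering_radius (L : set (action_space Ainf)) : \bar R :=
  ereal_sup [set ereal_inf [set (dA x y)%:E | y in L] | x in setT].

End action_space.

Definition tv_dist (R : realType) (disp : measure_display)
    (T : measurableType disp) (nu eta : {measure set T -> \bar R}) : \bar R :=
  (2%:E * ereal_sup [set `|nu B - eta B| | B in measurable])%E.

(* [q] is a selection of a nearest point of [L] to [f x]; its measurability is
   part of the type of [q] in the main statement. *)
Definition quantizes (R : realType) (d : nat) (A : set 'rV[R]_d)
    (Ainf : infinite_set A) (T : Type) (f q : T -> action_space Ainf)
    (L : set (action_space Ainf)) : Prop :=
  forall x, L (q x) /\ (forall a, L a -> dA (f x) (q x) <= dA (f x) a).

Section controlled_process.
Context (R : realType) (d1 d2 d3 : measure_display).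
Context (X : measurableType d1) (A : measurableType d2).
Context (Omega : measurableType d3) (P : probability Omega R).
Context (x_ : nat -> {mfun Omega >-> X}) (a_ : nat -> {mfun Omega >-> A}).

(* The sigma-algebra generated by [x_0, a_0, ..., x_n, a_n]. *)
Definition history (n : nat) : set (set Omega) :=
  <<s \bigcup_(i in [set i | (i <= n)%N])
        (preimage_set_system setT (x_ i) measurable `|`
         preimage_set_system setT (a_ i) measurable) >>.

(* [(x_n, a_n)_n] is a realization, on the probability space [(Omega, P)], of
   the decision process with transition probability [p] and initial
   distribution [mu], controlled by the deterministic stationary policy induced
   by [f]. Such a realization exists and its law is uniquely determined by
   [p, mu, f] (Ionescu-Tulcea). The last field states that [p (x_n, a_n)] is the
   conditional distribution of [x_(n+1)] given the past. *)
Record controlled_process (p : R.-pker (X * A) ~> X) (mu : probability X R)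
    (f : X -> A) : Prop := {
  cp_init : forall B, measurable B -> P (x_ 0 @^-1` B) = mu B ;
  cp_action : forall n, {ae P, forall w, a_ n w = f (x_ n w)} ;
  cp_transition : forall n H B, history n H -> measurable B ->
    P (H `&` x_ n.+1 @^-1` B) = (\int[P]_(w in H) p (x_ n w, a_ n w) B)%E }.

(* The series has nonnegative terms whenever [c] does. *)
Definition discounted_cost (beta : R) (c : X * A -> R) : \bar R :=
  (\int[P]_w \sum_(0 <= n <oo) (beta ^+ n * c (x_ n w, a_ n w))%:E)%E.

End controlled_process.

(* Main.v *)
Require Import Defs.
From HB Require Import structures.
From mathcomp Require Import all_boot all_order all_algebra.
From mathcomp Require Import all_classical all_reals all_analysis.
From mathcomp Require Import measurable_realfun ring lra.
Import Order.TTheory GRing.Theory Num.Theory numFieldNormedType.Exports.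
Local Open Scope classical_set_scope.
Local Open Scope ring_scope.

Set Implicit Arguments.
Unset Strict Implicit.
Unset Printing Implicit Defensive.

(** The two processes are compared through the laws of their states. Write
    [h] for the bound [alpha * (1 / k) ^ (1 / d)] on the covering radius of the
    grid, so that the actions prescribed by [f] and by [q k] are everywhere
    within [h]. As the kernel is Lipschitz in the action, one transition under
    [f] differs from one transition under [q k] by at most [eps = K2 * h / 2]
    on every Borel set, the factor 1/2 coming from the normalization of the
    total variation norm. These errors add up: the laws of the [n]-th states
    differ by at most [n * eps] on every Borel set ([law_le]), because
    integrating the [[0, 1]]-valued function [x |-> p (x, q k x) B] against two
    laws that are [delta]-close on sets gives [delta]-close results
    ([integral_le_setwise], by the layer cake formula). The same principle,
    applied to the cost and combined with its Lipschitz bound, controls the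
    difference of the expected costs at stage [n] by [K1 * h + n * M * eps]
    ([stage_cost_le]). Summing with weights [beta ^ n] gives
      [K1 * h / (1 - beta) + M * eps * beta / (1 - beta) ^ 2],
    which is smaller than the announced bound by
      [M * K2 * h * beta * (1 / 2 + beta) / (1 - beta) ^ 2].

    Each comparison is stated as an upper bound of one process by the other;
    exchanging the two policies gives the other half of the absolute value. In
    this form the extended-real inequalities can be chained without
    subtraction. *)

(** * Integrals and series under small perturbations *)

(** By the layer cake formula the integral of [g] is the integral of its tail
    probabilities over [[0, M]], and each tail changes by at most [delta]. *)
Lemma integral_le_setwise (R : realType) (disp : measure_display)
    (T : measurableType disp) (P Q : probability T R) (g : {mfun T >-> R})
    (M delta : R) :
  (forall x, 0 <= g x <= M) -> 0 <= M -> 0 <= delta ->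
  (forall B, measurable B -> P B <= Q B + delta%:E)%E ->
  (\int[P]_x (g x)%:E <= \int[Q]_x (g x)%:E + (M * delta)%:E)%E.
Proof.
move=> gM M0 delta0 PQ.
have g0 x : 0 <= g x by case/andP: (gM x).
have := @ge0_expectation_ccdf _ _ _ P g g0; rewrite unlock /= => ->.
have := @ge0_expectation_ccdf _ _ _ Q g g0; rewrite unlock /= => ->.
pose D : set (measurableTypeR R) := `[0%R, +oo[%classic.
pose h (r : measurableTypeR R) := (delta * \1_(`[0, M]%classic : set R) r)%:E.
have mD : measurable D by exact: measurable_itv.
have mh : measurable_fun D h.
  apply/measurable_EFinP/measurable_funM; first exact: measurable_cst.
  by apply: measurable_indic; exact: measurable_itv.
have h0 r : D r -> (0 <= h r)%E by move=> _; rewrite lee_fin mulr_ge0.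
have mccdf (P' : probability T R) : measurable_fun D (ccdf (P := P') g).
  by apply: measurable_funTS; exact: ccdf_measurable.
have int_h : (\int[lebesgue_measure]_(r in D) h r)%E = (M * delta)%:E.
  under eq_integral do rewrite /h EFinM.
  rewrite ge0_integralZl_EFin//; last first.
    apply/measurable_EFinP.
    by apply: measurable_indic; exact: measurable_itv.
  rewrite integral_indic// setIidl; last first.
    by move=> r /=; rewrite /D /= !in_itv/= => /andP[->].
  rewrite (_ : _ `[0, M]%classic = M%:E) 1?mulrC//.
  have := lebesgue_measure_itv `[0, M]; rewrite /= lte_fin => ->.
  by case: ltgtP M0 => // [_ _|<- _]; rewrite ?oppr0 ?adde0.
rewrite -int_h -ge0_integralD//.
apply: ge0_le_integral => //.
  by apply: emeasurable_funD.
move=> r; rewrite /D /= in_itv/= andbT => r0.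
have mr : measurable (g @^-1` `]r, +oo[).
  by rewrite -[X in measurable X]setTI; exact: measurable_funP.
have [rM|Mr] := leP r M.
  rewrite /h indicE mem_set ?mulr1; last by rewrite /= in_itv/= r0.
  exact: PQ.
(* [g] never exceeds [M], so both tails vanish beyond [M]. *)
rewrite /h indicE memNset ?mulr0 ?adde0; last first.
  by rewrite /= in_itv/= r0 /=; apply/negP; rewrite -ltNge.
rewrite /ccdf /distribution /pushforward.
have -> : g @^-1` `]r, +oo[ = set0; last by rewrite !measure0.
apply/seteqP; split => // x /=; rewrite in_itv/= andbT => rg.
by case/andP: (gM x) => _; rewrite leNgt (lt_trans Mr rg).
Qed.

Lemma integral_le_translate (R : realType) (disp : measure_display)
    (T : measurableType disp) (P : probability T R) (u v : T -> \bar R)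
    (e : R) :
  measurable_fun setT u -> measurable_fun setT v ->
  (forall x, 0 <= u x)%E -> (forall x, 0 <= v x)%E -> 0 <= e ->
  (forall x, u x <= v x + e%:E)%E ->
  (\int[P]_x u x <= \int[P]_x v x + e%:E)%E.
Proof.
move=> mu mv u0 v0 e0 uv.
rewrite [X in (_ <= _ + X)%E](_ : e%:E = \int[P]_x cst e%:E x)%E; last first.
  by rewrite integral_cst// [X in (_ * X)%E](probability_setT P) mule1.
rewrite -ge0_integralD//.
apply: ge0_le_integral => //.
by apply: emeasurable_funD => //; exact: measurable_cst.
Qed.

(** The weights [beta ^+ n * (a + n * b)] are the successive differences of
    the explicit remainder [tail] of their series, so partial sums telescope. *)
Lemma nneseries_arith_geo_le (R : realType) (beta a b : R) (u v : nat -> R) :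
  0 <= beta < 1 -> 0 <= a -> 0 <= b ->
  (forall n, 0 <= u n) -> (forall n, 0 <= v n) ->
  (forall n, u n <= v n + beta ^+ n * (a + n%:R * b)) ->
  (\sum_(0 <= n <oo) (u n)%:E <= \sum_(0 <= n <oo) (v n)%:E +
     (a / (1 - beta) + b * beta / (1 - beta) ^+ 2)%:E)%E.
Proof.
move=> /andP[beta0 beta1] a0 b0 u0 v0 uv.
have b1 : 0 < 1 - beta by rewrite subr_gt0.
have b1W := ltW b1.
pose w n := beta ^+ n * (a + n%:R * b).
pose tail n := beta ^+ n *
  (a / (1 - beta) + n%:R * b / (1 - beta) + b * beta / (1 - beta) ^+ 2).
have w0 n : 0 <= w n.
  by rewrite mulr_ge0 ?exprn_ge0// addr_ge0// mulr_ge0.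
have tail0 n : 0 <= tail n.
  rewrite mulr_ge0 ?exprn_ge0// !addr_ge0// ?divr_ge0 ?mulr_ge0 ?exprn_ge0//.
have wE n : w n = tail n - tail n.+1.
  rewrite /w /tail (exprS beta) -natr1; field.
  by rewrite gt_eqF.
have sum_w n : \sum_(0 <= i < n) w i = tail 0%N - tail n.
  elim: n => [|n IH]; first by rewrite big_geq// subrr.
  by rewrite big_nat_recr//= IH wE; ring.
have series_w : (\sum_(0 <= n <oo) (w n)%:E <= (tail 0%N)%:E)%E.
  apply: lime_le; first by apply: is_cvg_nneseries => n _ _; rewrite lee_fin.
  apply: nearW => n; rewrite sumEFin lee_fin sum_w.
  by rewrite lerBlDr lerDl.
have -> : a / (1 - beta) + b * beta / (1 - beta) ^+ 2 = tail 0%N.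
  by rewrite /tail expr0 mul1r !mul0r addr0.
apply: le_trans (leeD2l _ series_w).
rewrite -nneseriesD; [|by move=> n _ _; rewrite lee_fin..].
by apply: lee_nneseries => n _; rewrite -?EFinD lee_fin.
Qed.

(** * Expected costs stage by stage *)

Section stage_costs.
Context (R : realType) (d1 d2 d3 : measure_display).
Context (X : measurableType d1) (A : measurableType d2).
Context (Omega : measurableType d3) (P : probability Omega R).
Context (x_ : nat -> {mfun Omega >-> X}) (a_ : nat -> {mfun Omega >-> A}).
Context (c : X * A -> R) (M : R).
Hypothesis mc : measurable_fun setT c.
Hypothesis cM : forall z, 0 <= c z <= M.

Definition stage_cost n : R := fine (\int[P]_w (c (x_ n w, a_ n w))%:E)%E.

Lemma measurable_stage n : measurable_fun setT (fun w => c (x_ n w, a_ n w)).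
Proof.
apply: measurableT_comp mc _.
by apply: measurable_fun_pair; exact: measurable_funP.
Qed.

Lemma integral_stage_ge0 n : (0 <= \int[P]_w (c (x_ n w, a_ n w))%:E)%E.
Proof.
apply: integral_ge0 => w _; rewrite lee_fin.
by case/andP: (cM (x_ n w, a_ n w)).
Qed.

Lemma integral_stage_le n : (\int[P]_w (c (x_ n w, a_ n w))%:E <= M%:E)%E.
Proof.
have -> : M%:E = (\int[P]_w cst M%:E w)%E.
  by rewrite integral_cst// [X in (_ * X)%E](probability_setT P) mule1.
apply: ge0_le_integral => //.
- by move=> w _; rewrite lee_fin; case/andP: (cM (x_ n w, a_ n w)).
- exact/measurable_EFinP/measurable_stage.
- by move=> w _; rewrite lee_fin; case/andP: (cM (x_ n w, a_ n w)).
Qed.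

Lemma stage_costE n :
  (stage_cost n)%:E = (\int[P]_w (c (x_ n w, a_ n w))%:E)%E.
Proof.
rewrite fineK// ge0_fin_numE ?integral_stage_ge0//.
exact: le_lt_trans (integral_stage_le n) (ltry M).
Qed.

Lemma stage_cost_itv n : 0 <= stage_cost n <= M.
Proof.
by rewrite -!lee_fin stage_costE integral_stage_ge0 integral_stage_le.
Qed.

Lemma discounted_costE (beta : R) : 0 <= beta ->
  discounted_cost P x_ a_ beta c =
  (\sum_(0 <= n <oo) (beta ^+ n * stage_cost n)%:E)%E.
Proof.
move=> beta0; rewrite /discounted_cost integral_nneseries//; last 2 first.
- move=> n; apply/measurable_EFinP/measurable_funM => //.
  exact: measurable_stage.
- move=> n w _; rewrite lee_fin mulr_ge0 ?exprn_ge0//.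
  by case/andP: (cM (x_ n w, a_ n w)).
apply: eq_eseriesr => n _; rewrite EFinM stage_costE.
under eq_integral do rewrite EFinM.
rewrite ge0_integralZl_EFin ?exprn_ge0//.
- by move=> w _; rewrite lee_fin; case/andP: (cM (x_ n w, a_ n w)).
- exact/measurable_EFinP/measurable_stage.
Qed.

Lemma discounted_cost_fin_num (beta : R) : 0 <= beta < 1 ->
  discounted_cost P x_ a_ beta c \is a fin_num.
Proof.
move=> beta01; have /andP[beta0 _] := beta01.
have s0 n : 0 <= beta ^+ n * stage_cost n.
  by rewrite mulr_ge0 ?exprn_ge0//; case/andP: (stage_cost_itv n).
rewrite discounted_costE// ge0_fin_numE; last first.
  by apply: nneseries_ge0 => n _ _; rewrite lee_fin.
have M0 : 0 <= M by case/andP: (stage_cost_itv 0) => /le_trans /[apply].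
apply: le_lt_trans (nneseries_arith_geo_le (v := fun=> 0) beta01 M0 (lexx 0)
  s0 _ _) _ => //.
  move=> n; rewrite add0r mulr0 addr0 ler_wpM2l ?exprn_ge0//.
  by case/andP: (stage_cost_itv n).
by rewrite eseries0// add0e ltry.
Qed.

End stage_costs.

(** * Laws of the states under two policies *)

Section process_laws.
Context (R : realType) (d1 d2 : measure_display).
Context (X : measurableType d1) (A : measurableType d2).
Context (p : R.-pker (X * A) ~> X) (mu : probability X R).

Lemma measurable_graph (f : {mfun X >-> A}) :
  measurable_fun setT (fun x => (x, f x)).
Proof. by apply: measurable_fun_pair => //; exact: measurable_funP. Qed.

Lemma measurable_kernel_graph (f : {mfun X >-> A}) (B : set X) :
  measurable B -> measurable_fun setT (fun x => p (x, f x) B).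
Proof.
move=> mB.
exact: measurableT_comp (measurable_kernel p B mB) (measurable_graph f).
Qed.

Section one_process.
Context (d3 : measure_display) (Omega : measurableType d3).
Context (P : probability Omega R).
Context (x_ : nat -> {mfun Omega >-> X}) (a_ : nat -> {mfun Omega >-> A}).
Context (f : {mfun X >-> A}).
Hypothesis process : controlled_process P x_ a_ p mu f.

(** The action is almost surely a function of the state, so expectations at
    time [n] depend on the process only through the law of its state. *)
Lemma integral_state_action n (g : X * A -> \bar R) :
  measurable_fun setT g -> (forall z, 0 <= g z)%E ->
  (\int[P]_w g (x_ n w, a_ n w) = \int[distribution P (x_ n)]_x g (x, f x))%E.
Proof.
move=> mg g0; rewrite ge0_integral_distribution//; last first.
  exact: measurableT_comp mg (measurable_graph f).
apply: ge0_ae_eq_integral => //.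
- apply: measurableT_comp => //.
  by apply: measurable_fun_pair; exact: measurable_funP.
- apply: measurableT_comp; last exact: measurable_funP.
  exact: measurableT_comp mg (measurable_graph f).
- by move=> w _ /=; exact: g0.
- by move: (cp_action process n); apply: filterS => w /= -> _.
Qed.

(** The transition property for the trivial event [H = setT] already
    determines the laws of the states, one from the previous one. *)
Lemma law_succ n (B : set X) : measurable B ->
  (distribution P (x_ n.+1) B =
   \int[distribution P (x_ n)]_x p (x, f x) B)%E.
Proof.
move=> mB; rewrite -(integral_state_action n (g := p ^~ B))//; last first.
  exact: measurable_kernel.
rewrite /distribution /pushforward -[in LHS](setTI (_ @^-1` B)).
apply: (cp_transition process) => //.
by rewrite -setC0; apply: sigma_algebraC; exact: sigma_algebra0.
Qed.

End one_process.

Context (d3 d4 : measure_display).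
Context (Omega : measurableType d3) (Omega' : measurableType d4).
Context (P : probability Omega R) (P' : probability Omega' R).
Context (x_ : nat -> {mfun Omega >-> X}) (a_ : nat -> {mfun Omega >-> A}).
Context (x'_ : nat -> {mfun Omega' >-> X}) (a'_ : nat -> {mfun Omega' >-> A}).
Context (f g : {mfun X >-> A}).
Hypothesis process_f : controlled_process P x_ a_ p mu f.
Hypothesis process_g : controlled_process P' x'_ a'_ p mu g.
Context (eps : R).
Hypothesis eps_ge0 : 0 <= eps.
Hypothesis kernel_close : forall x B, measurable B ->
  (p (x, f x) B <= p (x, g x) B + eps%:E)%E.

(** From [n] to [n.+1]: replacing [f] by [g] in the last transition costs
    [eps], and replacing one law of the [n]-th state by the other inside the
    integral of the [[0, 1]]-valued map [x |-> p (x, g x) B] costs [n * eps]. *)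
Lemma law_le n (B : set X) : measurable B ->
  (distribution P (x_ n) B <=
   distribution P' (x'_ n) B + (n%:R * eps)%:E)%E.
Proof.
elim: n B => [|n IH] B mB.
  rewrite mul0r adde0 /distribution /pushforward.
  by rewrite (cp_init process_f mB) (cp_init process_g mB).
have pB_prob x : (p (x, g x) B <= 1)%E.
  rewrite -(prob_kernel (s := p) (x, g x)).
  by apply: le_measure; rewrite ?inE.
pose G x := fine (p (x, g x) B).
have GE x : (G x)%:E = p (x, g x) B.
  rewrite fineK// ge0_fin_numE ?measure_ge0//.
  exact: le_lt_trans (pB_prob x) (ltry 1).
have mG : measurable_fun setT G.
  apply/measurable_EFinP; rewrite (_ : _ \o _ = fun x => p (x, g x) B).
    exact: measurable_kernel_graph.
  by apply/funext => x /=; rewrite GE.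
pose G' : {mfun X >-> R} := HB.pack G (isMeasurableFun.Build _ _ _ _ G mG).
rewrite (law_succ process_f)// (law_succ process_g)//.
apply: (@le_trans _ _ (\int[distribution P (x_ n)]_x p (x, g x) B + eps%:E)%E).
  apply: integral_le_translate => //.
  - exact: measurable_kernel_graph.
  - exact: measurable_kernel_graph.
  - by move=> x; exact: kernel_close.
rewrite -natr1 mulrDl mul1r EFinD addeA; apply: leeD2r.
under eq_integral do rewrite -GE.
under [in leRHS]eq_integral do rewrite -GE.
rewrite -[n%:R * eps]mul1r.
apply: (@integral_le_setwise _ _ _ _ _ G') => //.
- move=> x; rewrite -!lee_fin GE measure_ge0 /=; exact: pB_prob.
- by rewrite mulr_ge0.
Qed.

(** Replacing [f] by [g] in the cost costs [eta]; replacing the law of the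
    [n]-th state under [f] by the one under [g] costs [M] times the bound of
    [law_le]. *)
Lemma stage_cost_le (c : X * A -> R) (M eta : R) n :
  measurable_fun setT c -> (forall z, 0 <= c z <= M) -> 0 <= M -> 0 <= eta ->
  (forall x, c (x, f x) <= c (x, g x) + eta) ->
  (\int[P]_w (c (x_ n w, a_ n w))%:E <=
   \int[P']_w (c (x'_ n w, a'_ n w))%:E + (eta + n%:R * (M * eps))%:E)%E.
Proof.
move=> mc cM M0 eta0 c_close.
have c0 z : (0 <= (c z)%:E)%E by rewrite lee_fin; case/andP: (cM z).
have mcE : measurable_fun setT (EFin \o c) by exact/measurable_EFinP.
rewrite (integral_state_action process_f n (g := EFin \o c))//.
rewrite (integral_state_action process_g n (g := EFin \o c))//=.
have mcg : measurable_fun setT (fun x => c (x, g x)).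
  exact: measurableT_comp (measurable_graph g).
pose G : {mfun X >-> R} :=
  HB.pack (fun x => c (x, g x)) (isMeasurableFun.Build _ _ _ _ _ mcg).
apply: (@le_trans _ _
    (\int[distribution P (x_ n)]_x (c (x, g x))%:E + eta%:E)%E).
  apply: integral_le_translate => //.
  - exact: measurableT_comp mcE (measurable_graph f).
  - exact/measurable_EFinP.
rewrite [eta + _]addrC EFinD addeA; apply: leeD2r.
rewrite mulrCA.
apply: (@integral_le_setwise _ _ _ _ _ G) => //.
- by move=> x; exact: cM.
- by rewrite mulr_ge0.
- by move=> B mB; exact: law_le.
Qed.

Lemma discounted_cost_le (c : X * A -> R) (M eta beta : R) :
  measurable_fun setT c -> (forall z, 0 <= c z <= M) -> 0 <= M -> 0 <= eta ->
  (forall x, c (x, f x) <= c (x, g x) + eta) -> 0 <= beta < 1 ->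
  (discounted_cost P x_ a_ beta c <= discounted_cost P' x'_ a'_ beta c +
     (eta / (1 - beta) + M * eps * beta / (1 - beta) ^+ 2)%:E)%E.
Proof.
move=> mc cM M0 eta0 c_close beta01; have /andP[beta0 _] := beta01.
rewrite !(discounted_costE _ _ _ mc cM)//.
apply: nneseries_arith_geo_le => //.
- by rewrite mulr_ge0.
- move=> n; rewrite mulr_ge0 ?exprn_ge0//.
  by case/andP: (stage_cost_itv P x_ a_ mc cM n).
- move=> n; rewrite mulr_ge0 ?exprn_ge0//.
  by case/andP: (stage_cost_itv P' x'_ a'_ mc cM n).
- move=> n; rewrite -mulrDr ler_wpM2l ?exprn_ge0// -lee_fin EFinD.
  by rewrite !(stage_costE _ _ _ mc cM); exact: stage_cost_le.
Qed.

End process_laws.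

(** * Total variation and quantization *)

(** The total variation norm is twice the largest discrepancy on sets. *)
Lemma tv_dist_le_setwise (R : realType) (disp : measure_display)
    (T : measurableType disp) (P Q : {measure set T -> \bar R}) (e : R)
    (B : set T) :
  (tv_dist P Q <= e%:E)%E -> measurable B -> P B \is a fin_num ->
  Q B \is a fin_num -> (P B <= Q B + (e / 2)%:E)%E.
Proof.
move=> PQe mB Pfin Qfin.
have : (2%:E * `|P B - Q B| <= e%:E)%E.
  apply: le_trans PQe; rewrite /tv_dist lee_pmul2l//.
  by apply: ereal_sup_ubound; exists B.
rewrite -(fineK Pfin) -(fineK Qfin) -EFinB abse_EFin -EFinM -EFinD !lee_fin.
by have := ler_norm (fine (P B) - fine (Q B)); lra.
Qed.

Lemma quantizes_le_covering_radius (R : realType) (d : nat) (A : set 'rV[R]_d)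
    (Ainf : infinite_set A) (T : Type) (f q : T -> action_space Ainf)
    (L : set (action_space Ainf)) (r : R) (x : T) :
  quantizes f q L -> (covering_radius L <= r%:E)%E -> dA (f x) (q x) <= r.
Proof.
move=> qL Lr; rewrite -lee_fin; apply: le_trans Lr.
have [_ qmin] := qL x.
apply: (@le_trans _ _ (ereal_inf [set (dA (f x) y)%:E | y in L])).
  by apply: le_ereal_inf_tmp => _ [a La <-]; rewrite lee_fin; exact: qmin.
by apply: ereal_sup_ubound; exists (f x).
Qed.

Lemma dAC (R : realType) (d : nat) (A : set 'rV[R]_d) (Ainf : infinite_set A)
    (a b : action_space Ainf) : dA a b = dA b a.
Proof.
rewrite /dA /euclidean_dist; congr Num.sqrt; apply: eq_bigr => i _.
by rewrite -sqrrN opprB.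
Qed.

(** * The error bound for quantized policies *)

Unset Implicit Arguments.

Theorem mainTheorem3 (R : realType)
  (X : ptopologicalType) (Xpolish : polish_space R X)
  (* (h) *)
  (d : nat) (d_ge1 : (1 <= d)%N)
  (A : set 'rV[R]_d) (Acompact : compact A) (Ainf : infinite_set A)
  (p : R.-pker (borel X * borel (action_space Ainf)) ~> borel X)
  (c : borel X * borel (action_space Ainf) -> R)
  (c_meas : measurable_fun setT c) (c_ge0 : forall xa, 0 <= c xa)
  (* (j) *)
  (c_bounded : bounded_fun c)
  (K1 : R) (K1_ge0 : 0 <= K1)
  (c_lip : forall (x : X) (a a' : action_space Ainf),
    `|c (x, a') - c (x, a)| <= K1 * dA a' a)
  (* (k) *)
  (K2 : R) (K2_ge0 : 0 <= K2)
  (p_lip : forall (x : X) (a a' : action_space Ainf),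
    (tv_dist (p (x, a')) (p (x, a)) <= (K2 * dA a' a)%:E)%E)
  (* the constant alpha and the grids Lambda_k *)
  (alpha : R) (alpha_gt0 : 0 < alpha)
  (Lambda : nat -> set (action_space Ainf))
  (Lambda_card : forall k, (1 <= k)%N -> (Lambda k #= `I_k)%card)
  (Lambda_cover : forall k, (1 <= k)%N ->
    (covering_radius (Lambda k) <= (alpha * (k%:R^-1) `^ (d%:R^-1))%:E)%E)
  (beta : R) (beta_gt0 : 0 < beta) (beta_lt1 : beta < 1)
  (* the policy pi and its quantized approximations *)
  (f : {mfun borel X >-> borel (action_space Ainf)})
  (q : nat -> {mfun borel X >-> borel (action_space Ainf)})
  (q_quant : forall k, (1 <= k)%N -> quantizes f (q k) (Lambda k))
  (mu : probability (borel X) R)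
  (k : nat) (k_ge1 : (1 <= k)%N)
  (* the process under pi *)
  (dO : measure_display) (Omega : measurableType dO) (P : probability Omega R)
  (x_ : nat -> {mfun Omega >-> borel X})
  (a_ : nat -> {mfun Omega >-> borel (action_space Ainf)})
  (process_f : controlled_process P x_ a_ p mu f)
  (* the process under pi^k *)
  (dO' : measure_display) (Omega' : measurableType dO')
  (P' : probability Omega' R)
  (x'_ : nat -> {mfun Omega' >-> borel X})
  (a'_ : nat -> {mfun Omega' >-> borel (action_space Ainf)})
  (process_q : controlled_process P' x'_ a'_ p mu (q k)) :
  let M := sup [set `|c xa| | xa in setT] in
  let K := alpha / (1 - beta) *
    (K1 - beta * K2 * M + 2 * beta * M * K2 / (1 - beta)) in
  ((`| discounted_cost P x_ a_ beta c - discounted_cost P' x'_ a'_ beta c |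
     <= (K * (k%:R^-1) `^ (d%:R^-1))%:E)%E : Prop).
Proof.
move=> M K.
set h := alpha * (k%:R^-1) `^ (d%:R^-1).
have h0 : 0 <= h by rewrite mulr_ge0 ?powR_ge0// ltW.
have fq x : dA (f x) (q k x) <= h.
  exact: quantizes_le_covering_radius (q_quant k k_ge1) (Lambda_cover k k_ge1).
have qf x : dA (q k x) (f x) <= h by rewrite dAC.
have cM z : 0 <= c z <= M.
  rewrite c_ge0 /= -[c z]ger0_norm//.
  apply: ub_le_sup; last by exists z.
  have [B [_ cB]] := c_bounded.
  (* [bounded_fun] gives the bounds strictly above [B] only *)
  exists (B + 1) => _ [y _ <-].
  by apply: (cB (B + 1)) => //; rewrite ltrDl.
have M0 : 0 <= M by have /andP[/le_trans] := cM point; apply.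
have pfin z B : measurable B -> p z B \is a fin_num.
  move=> mB; rewrite ge0_fin_numE//.
  apply: (@le_lt_trans _ _ 1%E); last exact: ltry.
  by rewrite -(prob_kernel (s := p) z); apply: le_measure; rewrite ?inE.
pose eps := K2 * h / 2.
have eps0 : 0 <= eps by rewrite divr_ge0// mulr_ge0.
have K1h0 : 0 <= K1 * h by rewrite mulr_ge0.
have p_close x a a' B : dA a' a <= h -> measurable B ->
    (p (x, a') B <= p (x, a) B + eps%:E)%E.
  move=> aa' mB; apply: tv_dist_le_setwise => //; try exact: pfin.
  apply: le_trans (p_lip _ _ _) _.
  by rewrite lee_fin ler_wpM2l.
have c_close x a a' : dA a' a <= h -> c (x, a') <= c (x, a) + K1 * h.
  move=> aa'; rewrite -lerBlDl; apply: le_trans (ler_norm _) _.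
  by apply: le_trans (c_lip _ _ _) _; rewrite ler_wpM2l.
have beta01 : 0 <= beta < 1 by rewrite beta_lt1 ltW.
have b1 : 0 < 1 - beta by rewrite subr_gt0.
set C := K1 * h / (1 - beta) + M * eps * beta / (1 - beta) ^+ 2.
have wf : (discounted_cost P x_ a_ beta c <=
    discounted_cost P' x'_ a'_ beta c + C%:E)%E.
  apply: (discounted_cost_le process_f process_q eps0) => //.
  - by move=> x B; exact: p_close.
  - by move=> x; exact: c_close.
have wq : (discounted_cost P' x'_ a'_ beta c <=
    discounted_cost P x_ a_ beta c + C%:E)%E.
  apply: (discounted_cost_le process_q process_f eps0) => //.
  - by move=> x B; exact: p_close.
  - by move=> x; exact: c_close.
have CK : C <= K * (k%:R^-1) `^ (d%:R^-1).
  rewrite -subr_ge0.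
  have -> : K * (k%:R^-1) `^ (d%:R^-1) - C =
      M * K2 * h * beta * (1 / 2 + beta) / (1 - beta) ^+ 2.
    by rewrite /K /C /eps /h; field; rewrite gt_eqF.
  have [[alpha0 beta0] b1W] := (ltW alpha_gt0, ltW beta_gt0, ltW b1).
  by rewrite divr_ge0 ?exprn_ge0// !mulr_ge0 ?addr_ge0 ?powR_ge0.
move: wf wq.
rewrite -(fineK (discounted_cost_fin_num P x_ a_ c_meas cM beta01)).
rewrite -(fineK (discounted_cost_fin_num P' x'_ a'_ c_meas cM beta01)).
rewrite -EFinB abse_EFin -!EFinD !lee_fin => wf wq.
apply: le_trans CK; rewrite ler_norml.
by apply/andP; split; lra.
Qed.
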